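(* For any finite alphabet $\Sigma$ of size at least $3$ and for any integer $k\ge 2$, the languages $\mathrm{LL}(\sim_k,\Sigma)$ and $\mathrm{Sing}(\sim_k,\Sigma)$ are not context-free.
   Context: The alphabet is a totally ordered finite set $\Sigma=\{1<\cdots<m\}$, and $\le$ also denotes the induced lexicographic order on the set $\Sigma^*$ of finite words. For words $u,x$, $\binom{u}{x}$ is the number of times $x$ appears as a (not necessarily contiguous) subsequence of $u$. Two words $u,v\in\Sigma^*$ are $k$-binomially equivalent, $u\sim_k v$, if $\binom{u}{x}=\binom{v}{x}$ for all words $x$ of length at most $k$. Write $[w]_{\sim_k}$ for the equivalence class of $w$. Then $\mathrm{LL}(\sim_k,\Sigma)=\{w\in\Sigma^*\mid \forall u\in[w]_{\sim_k}: w\le u\}$ is the language of lexicographically least elements of the classes, and $\mathrm{Sing}(\sim_k,\Sigma)=\{w\in\Sigma^*\mid \#[w]_{\sim_k}=1\}$ is the language of singletons. *)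

(* Defs.v *)
From mathcomp Require Import all_boot all_order.
From Stdlib Require Import Relation_Operators.

Set Implicit Arguments.
Unset Strict Implicit.
Unset Printing Implicit Defensive.

Definition language (T : Type) := seq T -> Prop.

(* Symbols are inl A for a nonterminal A and inr a for a terminal a;
   a production A -> rhs is the pair (A, rhs), where rhs may be empty. *)
Record cfg (T : finType) := Cfg {
  nonterminal : finType;
  start : nonterminal;
  productions : seq (nonterminal * seq (nonterminal + T))
}.

Definition derives1 (T : finType) (G : cfg T)
    (s t : seq (nonterminal G + T)) : Prop :=
  exists p q A rhs,
    [/\ (A, rhs) \in productions G,
        s = p ++ inl A :: q & t = p ++ rhs ++ q].

Definition derives (T : finType) (G : cfg T) :=
  clos_refl_trans (seq (nonterminal G + T)) (@derives1 T G).

Definition cfg_language (T : finType) (G : cfg T) : language T :=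
  fun w => @derives T G [:: inl (start G)] (map inr w).

Definition context_free (T : finType) (L : language T) : Prop :=
  exists G : cfg T, forall w, L w <-> cfg_language G w.

(* A bit mask of length size u is a set of positions of u. *)
Definition word_binom (T : eqType) (u x : seq T) : nat :=
  #|[set m : (size u).-tuple bool | mask m u == x]|.

Definition binom_equiv (T : eqType) (k : nat) (u v : seq T) : Prop :=
  forall x : seq T, size x <= k -> word_binom u x = word_binom v x.

(* seqlexi T is seq T ordered lexicographically, a proper prefix of a word
   being smaller than the word. *)
Definition LL (d : Order.disp_t) (T : finOrderType d) (k : nat) : language T :=
  fun w => forall u : seq T,
    binom_equiv k w u -> (w <= u :> seqlexi T)%O.

Definition Sing (T : eqType) (k : nat) : language T :=
  fun w => exists! u : seq T, binom_equiv k w u.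

(* Main.v *)
(* Write P_0 = x, Q_0 = y, P_(j+1) = P_j Q_j and Q_(j+1) = Q_j P_j; then P_j and
   Q_j are j-binomially equivalent. Hence a word of Sing or LL cannot have P_(k+1)
   as a factor unless x and y commute. In a grammar for such a language, all the
   words u occurring in derivations A =>* u A v commute, and so do all the words v.
   Cutting a parse tree at the last occurrence of A and inducting on the number of
   available nonterminals, one finds that every derived word is a concatenation of
   boundedly many words of bounded period. When all the blocks of equal letters are
   longer than these periods, each such word meets at most two blocks, so the number
   of blocks is bounded. On the other hand, already for k = 2, a word in which the
   letters a, b, c alternate cyclically in blocks of fast growing lengths is alone
   in its class, whatever the number of blocks. *)
Require Import Defs.
From mathcomp Require Import all_boot all_order.
From mathcomp Require Import zify.
From Stdlib Require Import Classical Relation_Operators.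

Set Implicit Arguments.
Unset Strict Implicit.
Unset Printing Implicit Defensive.

(** * Binomial coefficients of words *)

Section Binomials.

Variable T : eqType.
Implicit Types (u v w x p q : seq T) (a b c : T).

Lemma word_binom_nil u : word_binom u [::] = 1.
Proof.
rewrite /word_binom.
rewrite -(cards1 [tuple of nseq (size u) false]); apply: eq_card => m.
rewrite !inE -val_eqE /=.
case: m => /= m /eqP; elim: u m => [|c u IH] [|[] m] //= [/IH E].
by rewrite E.
Qed.

Lemma word_binom_nilE a x : word_binom [::] (a :: x) = 0.
Proof. by apply/eqP; rewrite cards_eq0; apply/eqP/setP => m; rewrite !inE mask0. Qed.

Lemma word_binom_cons c u a x :
  word_binom (c :: u) (a :: x) =
  word_binom u (a :: x) + (c == a) * word_binom u x.
Proof.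
rewrite /word_binom.
pose f (b : bool) (t : (size u).-tuple bool) := cons_tuple b t.
have f_inj (b : bool) : injective (f b).
  by move=> s t /(congr1 val) [] /val_inj.
have -> : [set m : (size (c :: u)).-tuple bool | mask m (c :: u) == a :: x] =
    f false @: [set t : (size u).-tuple bool | mask t u == a :: x] :|:
    f true @: [set t : (size u).-tuple bool | (c == a) && (mask t u == x)].
  apply/setP => m; case/tupleP: m => [[] t]; rewrite !inE /=.
    rewrite eqseq_cons -[cons_tuple true t]/(f true t).
    rewrite (mem_imset _ _ (@f_inj true)) inE orbC.
    by case: imsetP => [[s _ /(congr1 val)]|]; rewrite ?orbF.
  rewrite -[cons_tuple false t]/(f false t).
  rewrite (mem_imset _ _ (@f_inj false)) inE.
  by case: imsetP => [[s _ /(congr1 val)]|]; rewrite ?orbF.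
rewrite cardsU disjoint_setI0 ?cards0 ?subn0.
  rewrite !card_imset //; congr (_ + _).
  case: (c == a) => /=; first by rewrite mul1n.
  by rewrite mul0n; apply/eqP; rewrite cards_eq0; apply/eqP/setP => m; rewrite !inE.
rewrite disjoint_subset; apply/subsetP => m /imsetP [s _ ->]; rewrite !inE.
by apply/imsetP => -[t _ /(congr1 val)].
Qed.

Lemma word_binom_cat u v x :
  word_binom (u ++ v) x =
  \sum_(i < (size x).+1) word_binom u (take i x) * word_binom v (drop i x).
Proof.
elim: u x => [|c u IH] [|a x] /=.
- by rewrite big_ord_recl big_ord0 /= !word_binom_nil.
- rewrite big_ord_recl /= !word_binom_nil mul1n big1 ?addn0 // => i _.
  by rewrite word_binom_nilE.
- by rewrite big_ord_recl big_ord0 /= !word_binom_nil.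
rewrite word_binom_cons !IH /=.
rewrite big_ord_recl [in RHS]big_ord_recl /= !word_binom_nil -addnA; congr (_ + _).
rewrite big_distrr -big_split /=; apply: eq_bigr => i _.
by rewrite /= word_binom_cons mulnDl mulnA.
Qed.

Lemma binom_equiv_cat k u u' v v' :
  binom_equiv k u u' -> binom_equiv k v v' -> binom_equiv k (u ++ v) (u' ++ v').
Proof.
move=> uu vv x xk; rewrite !word_binom_cat; apply: eq_bigr => i _.
rewrite uu ?vv // ?size_drop ?size_take_min; lia.
Qed.

(* In the convolution formula for [word_binom (u ++ v) x] only the two extreme
   terms involve a word longer than [k]. *)
Lemma binom_equiv_catC k u v :
  binom_equiv k u v -> binom_equiv k.+1 (u ++ v) (v ++ u).
Proof.
move=> uv [|a x] xk; first by rewrite !word_binom_nil.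
rewrite !word_binom_cat /=.
rewrite big_ord_recl [in RHS]big_ord_recl big_ord_recr [in RHS]big_ord_recr /=.
rewrite take_size drop_size !word_binom_nil !mul1n !muln1.
have -> : \sum_(i < size x) word_binom u (a :: take i x) * word_binom v (drop i x)
  = \sum_(i < size x) word_binom v (a :: take i x) * word_binom u (drop i x).
  apply: eq_bigr => i _; congr (_ * _); [|symmetry]; apply: uv;
    by move: xk (ltn_ord i); rewrite /= ?size_drop ?size_take_min; lia.
under [X in _ = _ + (X + _)]eq_bigr => i _ do rewrite !add0n.
by rewrite addnC -addnA [RHS]addnCA.
Qed.

(** Swapping the arguments gives Q_j, so one recursion serves both words. For distinct letters [x],
    [y] this is the Thue-Morse prefix of length 2^j. *)
Fixpoint prouhet j x y : seq T :=
  if j is j'.+1 then prouhet j' x y ++ prouhet j' y x else x.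

Lemma prouhet_equiv j x y : binom_equiv j (prouhet j x y) (prouhet j y x).
Proof.
elim: j x y => [|j IH] x y /=; last exact: binom_equiv_catC.
by case=> //; rewrite !word_binom_nil.
Qed.

(** The index starts at 1 because [x] and [y] may differ in length. *)
Lemma size_prouhet j x y : size (prouhet j.+1 x y) = size (prouhet j.+1 y x).
Proof. by rewrite /= !size_cat addnC. Qed.

(** Corresponding halves have the same length, so the equality passes to the first halves and
    descends to index 1, where it reads [x ++ y = y ++ x]. *)
Lemma prouhet_inj j x y :
  prouhet j.+1 x y = prouhet j.+1 y x -> x ++ y = y ++ x.
Proof.
elim: j => [//|j IH] /eqP.
have E z t : prouhet j.+2 z t = prouhet j.+1 z t ++ prouhet j.+1 t z by [].
by rewrite !{}E (eqseq_cat _ _ (size_prouhet j x y)) => /andP [/eqP /IH].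
Qed.

(** Replacing the first half P_k of P_(k+1) by the equivalent Q_k stays in the class, so uniqueness
    forces P_k = Q_k. *)
Lemma Sing_prouhet k p q x y : 0 < k ->
  Sing k (p ++ prouhet k.+1 x y ++ q) -> x ++ y = y ++ x.
Proof.
case: k => // k _ [u [_ uniq_u]].
have E z : binom_equiv k.+1 (prouhet k.+1 x y) z ->
    u = p ++ (z ++ prouhet k.+1 y x) ++ q.
  by move=> yz; apply: uniq_u; do !apply: binom_equiv_cat.
apply/(@prouhet_inj k)/eqP.
have := E _ (fun _ _ => erefl); rewrite (E _ (@prouhet_equiv _ _ _)).
move/eqP; rewrite eqseq_cat // eqxx /= eqseq_cat; last by rewrite /= !size_cat; lia.
by case/andP; rewrite eqseq_cat; [case/andP => /eqP -> | rewrite size_prouhet].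
Qed.

(** * Counts of two-letter subsequences *)

Fixpoint pairs a b w : nat :=
  if w is c :: w' then pairs a b w' + (c == a) * count_mem b w' else 0.

Lemma word_binom1 u a : word_binom u [:: a] = count_mem a u.
Proof.
elim: u => [|c u IH]; first by rewrite word_binom_nilE.
by rewrite word_binom_cons IH word_binom_nil muln1 addnC.
Qed.

Lemma word_binom2 u a b : word_binom u [:: a; b] = pairs a b u.
Proof.
elim: u => [|c u IH]; first by rewrite word_binom_nilE.
by rewrite word_binom_cons IH word_binom1.
Qed.

Lemma pairs_cat a b u v :
  pairs a b (u ++ v) =
  pairs a b u + count_mem a u * count_mem b v + pairs a b v.
Proof. by elim: u => //= c u ->; rewrite count_cat; lia. Qed.

Lemma pairsC a b w : a != b ->
  pairs a b w + pairs b a w = count_mem a w * count_mem b w.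
Proof.
move=> ab; elim: w => //= c w IH.
case: (eqVneq c a) => [->|ca]; rewrite ?(negbTE ab); first by lia.
by case: (c == b); lia.
Qed.

Lemma pairs_notin_r a b w : count_mem b w = 0 -> pairs a b w = 0.
Proof. by elim: w => //= c w IH E; rewrite IH; lia. Qed.

Lemma pairs_notin_l a b w : count_mem a w = 0 -> pairs a b w = 0.
Proof. by elim: w => //= c w IH E; rewrite IH; lia. Qed.

Lemma pairs_le a b w : a != b -> pairs a b w <= count_mem a w * count_mem b w.
Proof. by move/(pairsC w) <-; rewrite leq_addr. Qed.

Lemma pairs0_blocks a c w : a != c ->
  all [in [:: a; c]] w -> pairs a c w = 0 ->
  w = nseq (count_mem c w) c ++ nseq (count_mem a w) a.
Proof.
move=> ac; elim: w => //= d w IH /andP [+ /IH {}IH].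
rewrite !inE => /orP [] /eqP -> E.
  have c0 : count_mem c w = 0 by move: E; rewrite eqxx; lia.
  have /IH {}IH : pairs a c w = 0 by lia.
  by rewrite eqxx (negbTE ac) c0 /=; rewrite c0 in IH; congr (_ :: _).
have /IH {}IH : pairs a c w = 0 by lia.
by rewrite eqxx eq_sym (negbTE ac) /=; congr (_ :: _).
Qed.

Lemma split_last b w : exists u v,
  [/\ w = u ++ v, count_mem b v = 0 & u = [::] \/ exists u', u = rcons u' b].
Proof.
elim/last_ind: w => [|w c [u [v [-> v0 Hu]]]].
  by exists [::], [::]; split=> //; left.
case: (eqVneq c b) => [->|cb].
  exists (rcons (u ++ v) b), [::]; rewrite cats0; split=> //; right.
  by exists (u ++ v).
exists u, (rcons v c); rewrite rcons_cat; split=> //.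
by rewrite -cats1 count_cat v0 /= (negbTE cb).
Qed.

End Binomials.

(** * Singletons with many long blocks *)

Section Spiral.

Variables (T : eqType) (C : nat).
Implicit Types (a b c : T) (w : seq T).

(** The cubic term outweighs the error terms in [spiral_rigid], which are at most cubic in the
    length of the preceding word; [C] makes every block long. *)
Definition spiral_exponent l := C + (l + 2) ^ 3.

Lemma spiral_exponent_gt l : l * (l * l) + 2 * (l * l) < spiral_exponent l.
Proof. by rewrite /spiral_exponent !expnS expn0; nia. Qed.

(* [spiral a b c n] consists of [n] blocks; read from right to left their
   letters are c, b, a, c, b, a, ... *)
Fixpoint spiral a b c n : seq T :=
  if n is n'.+1 then
    let w := spiral c a b n' in w ++ nseq (spiral_exponent (size w)) c
  else [::].

Lemma spiralS a b c n : spiral a b c n.+1 =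
  spiral c a b n ++ nseq (spiral_exponent (size (spiral c a b n))) c.
Proof. by []. Qed.

(** By [pairsC], the inequality says that [ba] occurs less often than [b]: the last block, made of
    b's, follows every [a] and outnumbers all pairs of earlier positions. *)
Lemma spiral_pairs a b c n : uniq [:: a; b; c] ->
  let w := spiral c a b n in
  count_mem a w = 0 \/
  count_mem a w * count_mem b w < pairs a b w + count_mem b w.
Proof.
rewrite /= !inE negb_or => /andP [/andP [ab ac] /andP [bc _]].
case: n => [|n]; [by left | right => /=].
set w := spiral _ _ _ n; rewrite !count_cat !count_nseq pairs_cat count_nseq /=.
rewrite !eqxx (eq_sym b a) (negbTE ab) mul0n mul1n addn0.
rewrite (@pairs_notin_l _ a b (nseq _ _)) ?addn0; last first.
  by rewrite count_nseq /= (eq_sym b a) (negbTE ab).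
have := count_size (pred1 a) w; have := count_size (pred1 b) w.
rewrite /spiral_exponent; nia.
Qed.

(* The spiral is reconstructed from its last block on: cutting [v] after its
   last [b] yields the same hypotheses for the shorter spiral, with the letters
   rotated. *)
Lemma spiral_rigid a b c n v : uniq [:: a; b; c] ->
  let w := spiral a b c n in
  all [in [:: a; b; c]] v ->
  count_mem b v = count_mem b w -> count_mem c v = count_mem c w ->
  pairs b c w <= pairs b c v -> pairs a b w <= pairs a b v ->
  pairs a c v <= pairs a c w ->
  exists j, v = w ++ nseq j a.
Proof.
elim: n => [|n IH] in a b c v *; rewrite /= !inE negb_or.
  case/andP=> /andP [ab ac] /andP [bc _] Hv b0 c0 _ _ _.
  exists (size v); apply/all_pred1P/allP => x xv /=.
  move: (allP Hv x xv); rewrite !inE => /or3P [] // /eqP E.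
    by move/count_memPn: b0; rewrite -E xv.
  by move/count_memPn: c0; rewrite -E xv.
case/andP=> /andP [ab ac] /andP [bc _].
have cab : uniq [:: c; a; b].
  by rewrite /= !inE negb_or eq_sym ac eq_sym bc ab.
have abc : uniq [:: a; b; c] by rewrite /= !inE negb_or ab ac bc.
have [v1 [v2 [-> v20 Hv1]]] := split_last b v.
have := spiral_pairs n abc; move: (IH c a b v1 cab) => /=.
set w := spiral c a b n; set z := spiral_exponent _.
rewrite !all_cat !count_cat !pairs_cat !count_nseq /=.
have za : count_mem a (nseq z c) = 0 by rewrite count_nseq /= eq_sym (negbTE ac).
have zb : count_mem b (nseq z c) = 0 by rewrite count_nseq /= eq_sym (negbTE bc).
rewrite !(pairs_notin_l _ za) !(pairs_notin_l _ zb).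
rewrite !eqxx (eq_sym c b) (negbTE bc) v20.
rewrite (@pairs_notin_l _ b c v2) // (@pairs_notin_r _ a b v2) //.
rewrite !mul0n !muln0 !mul1n !addn0.
move=> {}IH Hw /andP [all1 all2] Eb Ec Hbc Hab Hac.
have := pairsC v1 bc; have := pairsC v1 ac.
have := pairsC w bc; have := pairsC w ac.
have cv1 : count_mem c v1 <= pairs c b v1.
  case: Hv1 => [->//|[u ->]]; rewrite -cats1 pairs_cat count_cat /= eqxx.
  by rewrite (negbTE bc); lia.
have := pairs_le v1 ab.
have : pairs c b w <= size w * size w.
  rewrite (leq_trans (pairs_le w _)) 1?eq_sym //.
  by rewrite leq_mul ?count_size.
have : pairs a c w <= size w * size w.
  by rewrite (leq_trans (pairs_le w ac)) // leq_mul ?count_size.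
have := count_size (pred1 a) w.
move=> aw acw cbw abv1 Eacw Ebcw Eacv Ebcv.
rewrite Eb in Ebcv abv1 Hbc.
(* Multiplying [Ec] by the number of b's turns the lower bound on [bc] into an upper bound on
   [cb]. *)
have cb_le : pairs c b v1 <= pairs c b w.
  by have := congr1 (muln (count_mem b w)) Ec; rewrite !mulnDr; lia.
(* Each [c] of [v1] precedes its final [b], so [v1] has few c's and [v2] nearly all of the last
   block. *)
have cv2 : z <= count_mem c v2 + size w * size w by lia.
(* An extra [a] in [v1] would precede all c's of [v2] and make [ac] too frequent. *)
have a_le : count_mem a v1 <= count_mem a w.
  rewrite leqNgt; apply/negP => lt.
  have : (count_mem a w).+1 * count_mem c v2 <= count_mem a v1 * count_mem c v2.
    by rewrite leq_mul2r lt orbT.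
  have : count_mem a w * z <=
      count_mem a w * count_mem c v2 + size w * (size w * size w).
    rewrite (leq_trans (leq_mul (leqnn _) cv2)) // mulnDr leq_add2l.
    by rewrite leq_mul2r aw orbT.
  have := spiral_exponent_gt (size w); rewrite -/z mulSn; lia.
(* With a missing [a], even all possible pairs would give fewer [ab] than [spiral_pairs] guarantees
   in [w]. *)
have a_ge : count_mem a w <= count_mem a v1.
  case: Hw => [->//|Hw]; rewrite leqNgt; apply/negP => lt.
  have : (count_mem a v1).+1 * count_mem b w <= count_mem a w * count_mem b w.
    by rewrite leq_mul2r lt orbT.
  by rewrite mulSn; lia.
have Ea : count_mem a v1 = count_mem a w by lia.
rewrite Ea in Eacv Hac.
(* The surplus [pairs a c v2] is kept: once [v1 = w] it must vanish, which puts all c's of [v2]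
   before its a's. *)
have ca_le : pairs c a w + pairs a c v2 <= pairs c a v1.
  by have := congr1 (muln (count_mem a w)) Ec; rewrite !mulnDr; lia.
have {}all1 : all [in [:: c; a; b]] v1.
  by apply: sub_all all1 => x; rewrite !inE => /or3P [] ->; rewrite ?orbT.
have [j Ev1] := IH all1 Ea Eb Hab (leq_trans (leq_addr _ _) ca_le) cb_le.
have j0 : j = 0.
  case: Hv1 Ev1 => [->|[u ->]]; first by case: (w) j => [|? ?] [].
  case: j => // j; rewrite -addn1 nseqD catA cats1 => /rcons_inj [_ E].
  by rewrite E eqxx in bc.
rewrite j0 cats0 in Ev1; subst v1.
have Ez : count_mem c v2 = z by lia.
exists (count_mem a v2); rewrite -catA; congr (_ ++ _).
rewrite -Ez; apply: pairs0_blocks => //; last by lia.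
apply/allP => x xv; move: (allP all2 x xv); rewrite !inE => /or3P [] /eqP E.
- by rewrite E eqxx.
- by move/count_memPn: v20; rewrite -E xv.
- by rewrite E eqxx orbT.
Qed.

Lemma spiral_letters a b c n : all [in [:: a; b; c]] (spiral a b c n).
Proof.
elim: n => //= n IH in a b c *; rewrite all_cat all_nseq !inE eqxx !orbT andbT.
by apply: sub_all (IH c a b) => x; rewrite !inE => /or3P [] ->; rewrite ?orbT.
Qed.

Lemma spiral_singleton a b c n u k : uniq [:: a; b; c] -> 2 <= k ->
  binom_equiv k (spiral a b c n) u -> u = spiral a b c n.
Proof.
move=> abc k2 E.
have E1 x : count_mem x u = count_mem x (spiral a b c n).
  by rewrite -!word_binom1 E //=; lia.
have E2 x y : pairs x y u = pairs x y (spiral a b c n).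
  by rewrite -!word_binom2 E.
have [||||||j Eu] := @spiral_rigid a b c n u abc; rewrite ?E1 ?E2 //.
  apply/allP => x xu; apply: (allP (spiral_letters a b c n)).
  by rewrite -has_pred1 has_count -E1 -has_count has_pred1.
(* Equal numbers of a's rule out the tail [nseq j a]. *)
have := E1 a; rewrite Eu count_cat count_nseq /= eqxx.
by case: j {Eu} => [|j]; rewrite ?cats0 //; lia.
Qed.

(** * Counting blocks, and words whose blocks are long *)

Fixpoint blocks w : nat :=
  if w is x :: w' then (ohead w' != Some x) + blocks w' else 0.

Lemma blocks_gt0 x w : 0 < blocks (x :: w).
Proof. by elim: w x => //= y w IH x; rewrite addn_gt0 IH orbT. Qed.

Lemma blocks_cat u w : blocks (u ++ w) <= blocks u + blocks w.
Proof.
elim: u => //= x [|y u] IH /=; last by rewrite /= in IH; lia.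
by case: (ohead w != Some x); lia.
Qed.

Lemma blocks_rcons_cat u x y w : x != y ->
  blocks (rcons u x ++ y :: w) = blocks (rcons u x) + blocks (y :: w).
Proof.
move=> xy; elim: u => [|z u IH]; last by rewrite /= in IH *; case: u IH => /= *; lia.
by rewrite /= addn0 (inj_eq (@Some_inj _)) eq_sym xy.
Qed.

Lemma blocks_nseq n x : blocks (nseq n x) <= 1.
Proof. by elim: n => //= -[|n] /=; rewrite ?eqxx //; lia. Qed.

Lemma spiral_last a b c n : exists u, spiral a b c n.+1 = rcons u c.
Proof.
set w := spiral c a b n; exists (w ++ nseq (spiral_exponent (size w)).-1 c).
rewrite -cats1 -catA -(nseqD _ 1) addn1 prednK //.
exact: leq_ltn_trans (spiral_exponent_gt _).
Qed.

Lemma blocks_spiral a b c n : uniq [:: a; b; c] -> n <= blocks (spiral a b c n).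
Proof.
elim: n => // n IH in a b c *; rewrite -(rot_uniq 2) => abc.
have {IH} := IH _ _ _ abc; case: n => [|n].
  by have [[|x u] ->] := spiral_last a b c 0; rewrite // blocks_gt0.
have bc : b != c.
  by move: abc; rewrite /= !inE negb_or => /andP [/andP [_ +] _]; rewrite eq_sym.
rewrite (spiralS a b c n.+1); have := spiral_exponent_gt (size (spiral c a b n.+1)).
case: spiral_exponent => // e _; have [u ->] := spiral_last c a b n.
rewrite blocks_rcons_cat // => le_n.
by rewrite -addn1 (leq_add le_n (blocks_gt0 _ _)).
Qed.

(* Whenever a new block starts, its first letter is followed by [C] copies of
   itself, unless the word ends before. *)
Fixpoint long_blocks w : bool :=
  if w is a :: w' then
    (if w' is b :: w'' then (a == b) || all (pred1 b) (take C w'') else true)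
    && long_blocks w'
  else true.

Lemma long_blocks_catr u w : long_blocks (u ++ w) -> long_blocks w.
Proof. by elim: u => //= a u IH /andP [_ /IH]. Qed.

Lemma long_blocks_catl u w : long_blocks (u ++ w) -> long_blocks u.
Proof.
elim: u => //= a u IH /andP [+ /IH ->]; rewrite andbT.
case: u {IH} => //= b u /orP [->//|H]; apply/orP; right.
by move: H; rewrite take_cat; case: ifP => // /negbT; rewrite -leqNgt all_cat => ?
  /andP [? _]; rewrite take_oversize.
Qed.

Lemma long_blocks_nseq_cat f y g x : long_blocks (nseq f y ++ nseq g x).
Proof.
have long_nseq : long_blocks (nseq g x).
  by elim: g => //= -[|g] //= ->; rewrite eqxx.
elim: f => [//|[|f] IH] /=; last by rewrite eqxx.
case: g long_nseq {IH} => //= g ->; rewrite andbT; apply/orP; right.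
by apply/allP => z /mem_take; rewrite mem_nseq => /andP [].
Qed.

(** The block of y's fills the window of [C] letters after any earlier change of letter, so no check
    inside [w] sees the appended letters. *)
Lemma long_blocks_extend w f y g x : C < f ->
  long_blocks (w ++ nseq f y) -> long_blocks (w ++ nseq f y ++ nseq g x).
Proof.
move=> Cf; elim: w => [|a w IH]; first by rewrite long_blocks_nseq_cat.
rewrite /= => /andP [H /IH ->]; rewrite andbT.
case: w {IH} H => [|b w] /=.
  case: f Cf => //= f Cf; rewrite takel_cat ?size_nseq //; lia.
by rewrite catA [take C (_ ++ nseq g x)]takel_cat // size_cat size_nseq; lia.
Qed.

Lemma long_blocks_spiral a b c n : long_blocks (spiral a b c n).
Proof.
elim: n => //= -[_|n IH] in a b c *; first exact: (@long_blocks_nseq_cat 0).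
rewrite /= -catA; apply: long_blocks_extend; last exact: IH.
have : 0 < (size (spiral b c a n) + 2) ^ 3 by rewrite expn_gt0 addn2.
by rewrite /spiral_exponent; lia.
Qed.

Lemma constant_prefix w : w = [::] \/
  exists a i, w = nseq i.+1 a \/ exists b t, a != b /\ w = nseq i.+1 a ++ b :: t.
Proof.
elim: w => [|a w [->|[b [i IH]]]]; [by left | right..].
  by exists a, 0; left.
case: (eqVneq a b) => [->|ab].
  by exists b, i.+1; case: IH => [->|[c [t [bc ->]]]]; [left | right; exists c, t].
exists a, 0; right; exists b.
by case: IH => [->|[c [t [bc ->]]]]; [exists (nseq i b) | exists (nseq i b ++ c :: t)].
Qed.

(* [u] has period [size r <= C], whereas a change of letter followed by [C] equal
   letters breaks that period. *)
Lemma long_blocks_commute u r : long_blocks u -> 0 < size r <= C ->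
  u ++ r = r ++ u -> blocks u <= 2.
Proof.
move=> long_u /andP [r0 rC] ur.
case: (constant_prefix u) => [->//|[a [i [->|[b [t [ab E]]]]]]].
  by rewrite (leq_trans (blocks_nseq _ _)).
have t_b : all (pred1 b) (take C t).
  move: long_u; rewrite E -addn1 nseqD -catA => /long_blocks_catr /=.
  by rewrite (negbTE ab) => /andP [].
(* Position [i] ends the first block. If [u] reaches position [size r + i], periodicity puts an [a]
   there, among the forced b's; otherwise everything after the first block is forced to be [b]. *)
have [lt|ge] := ltnP (size r + i) (size u).
  have := congr1 (fun s => nth a s (size r + i)) ur.
  rewrite /= nth_cat lt nth_cat ltnNge leq_addr /= addKn E.
  have ri : (size r + i < i.+1) = false by lia.
  rewrite !nth_cat !size_nseq ri ltnSn (nth_nseq _ _ _ i) ltnSn.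
  case: (size r) r0 rC lt => // -[|m] _ rC lt /=.
    by rewrite subnn /= => E'; rewrite E' eqxx in ab.
  have -> : m.+2 + i - i.+1 = m.+1 by lia.
  rewrite /= => E'; move: lt; rewrite E size_cat size_nseq /= => lt.
  have : nth a (take C t) m == b.
    by apply: (allP t_b); rewrite mem_nth // size_take_min; lia.
  by rewrite nth_take 1?E' ?(negbTE ab) //; lia.
have t_short : size t <= C by move: ge; rewrite E size_cat size_nseq /=; lia.
move: t_b; rewrite E take_oversize // => /all_pred1P ->.
apply: leq_trans (blocks_cat _ _) _.
exact: leq_add (blocks_nseq i.+1 a) (blocks_nseq (size t).+1 b).
Qed.

End Spiral.

(** * Least elements of classes avoid Prouhet factors *)

Section LexicographicallyLeast.

Variables (d : Order.disp_t) (T : finOrderType d).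
Implicit Types p q s t x y : seq T.

(** With equal lengths, [s] and [t] coincide or their first difference decides, whatever follows. *)
Lemma lexi_factor p s t q q' : size s = size t ->
  (p ++ s ++ q <= p ++ t ++ q' :> seqlexi T)%O -> (s <= t :> seqlexi T)%O.
Proof.
move=> st; elim: p => [|a p IH] /=; last by rewrite Order.SeqLexiOrder.eqhead_lexiE.
elim: s t st => [|x s IH] [|y t] //= [st].
rewrite !Order.SeqLexiOrder.lexi_cons => /andP [-> /implyP H] /=.
by apply/implyP => /H; apply: IH.
Qed.

(** In the factor PQ, minimality against QQ gives P <= Q and against PP gives Q <= P. *)
Lemma LL_prouhet k p q x y : 0 < k ->
  LL k (p ++ prouhet k.+1 x y ++ q) -> x ++ y = y ++ x.
Proof.
case: k => // k _ min; apply: (@prouhet_inj _ k).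
have yx := @prouhet_equiv _ k.+1 x y; set P := prouhet _ x y in yx *.
set Q := prouhet _ y x in yx *.
have refl (w : seq T) : binom_equiv k.+1 w w by [].
have PQ : size P = size Q by exact: size_prouhet.
have {}min P' Q' : binom_equiv k.+1 P P' -> binom_equiv k.+1 Q Q' ->
    (p ++ P ++ Q ++ q <= p ++ P' ++ Q' ++ q :> seqlexi T)%O.
  move=> PP QQ; rewrite (catA P) (catA P').
  by apply: min; do !apply: binom_equiv_cat.
apply/eqP; rewrite (@Order.POrderTheory.eq_le _ (seqlexi T)); apply/andP; split.
  exact: lexi_factor PQ (min Q Q yx (refl _)).
have QP : binom_equiv k.+1 Q P by move=> z /yx.
have := min P P (refl _) QP.
by rewrite !(catA p); apply: lexi_factor; rewrite PQ.
Qed.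

End LexicographicallyLeast.

(** * Block bounds in context-free languages *)

Section Grammar.

Variables (T : finType) (G : cfg T).
Implicit Types (s t : seq (nonterminal G + T)) (A B : nonterminal G).
Implicit Types (u v w : seq T) (S : {set nonterminal G}).

Local Notation derive := (@derives T G).
Local Notation word w := (map (@inr (nonterminal G) T) w).

Lemma derives_context p q s t : derive s t -> derive (p ++ s ++ q) (p ++ t ++ q).
Proof.
elim=> {s t} [s t [p' [q' [A [rhs [AG -> ->]]]]]|s|s t r _ IH1 _ IH2].
- apply: rt_step; exists (p ++ p'), (q' ++ q), A, rhs.
  by rewrite -!catA.
- exact: rt_refl.
- exact: rt_trans IH1 IH2.
Qed.

Lemma derives_cat s t s' t' : derive s t -> derive s' t' -> derive (s ++ s') (t ++ t').
Proof.
move=> st st'; apply: rt_trans (derives_context [::] s' st) _.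
by have := derives_context t [::] st'; rewrite !cats0.
Qed.

Lemma derives_prod A rhs : (A, rhs) \in productions G -> derive [:: inl A] rhs.
Proof.
by move=> AG; apply: rt_step; exists [::], [::], A, rhs; rewrite cats0.
Qed.

(* Parse forests, read off as a word, in which only nonterminals from [S] are
   expanded. *)
Inductive yields S : seq (nonterminal G + T) -> seq T -> Prop :=
| YieldsNil : yields S [::] [::]
| YieldsTerminal a s w : yields S s w -> yields S (inr a :: s) (a :: w)
| YieldsNonterminal A rhs s w1 w2 :
    A \in S -> (A, rhs) \in productions G -> yields S rhs w1 -> yields S s w2 ->
    yields S (inl A :: s) (w1 ++ w2).

Lemma yields_derives S s w : yields S s w -> derive s (word w).
Proof.
elim=> {s w} [|a s w _ IH|A rhs s w1 w2 _ AG _ IH1 _ IH2]; first exact: rt_refl.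
  exact: (derives_cat (rt_refl _ _ [:: inr a]) IH).
rewrite map_cat -cat1s; apply: derives_cat IH2.
exact: rt_trans (derives_prod AG) IH1.
Qed.

Lemma yields_cat S s1 s2 w1 w2 :
  yields S s1 w1 -> yields S s2 w2 -> yields S (s1 ++ s2) (w1 ++ w2).
Proof.
move=> H H2; elim: H => {s1 w1} //= [a s w _ IH|A rhs s w w' AS AG Hrhs _ _ IH].
  exact: YieldsTerminal.
rewrite -catA; exact: YieldsNonterminal AS AG Hrhs IH.
Qed.

Lemma yields_catP S s1 s2 w : yields S (s1 ++ s2) w ->
  exists w1 w2, [/\ w = w1 ++ w2, yields S s1 w1 & yields S s2 w2].
Proof.
elim: s1 w => [|X s1 IH] w /= H; first by exists [::], w; split=> //; constructor.
inversion H as [|a s w' Hs|A rhs s w1 w2 AS AG Hrhs Hs]; subst.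
  have [v1 [v2 [-> H1 H2]]] := IH _ Hs.
  by exists (a :: v1), v2; split=> //; constructor.
have [v1 [v2 [-> H1 H2]]] := IH _ Hs.
by exists (w1 ++ v1), v2; rewrite catA; split=> //; exact: YieldsNonterminal AS AG Hrhs H1.
Qed.

Lemma yields_word S w : yields S (word w) w.
Proof. by elim: w => [|a w IH] /=; constructor. Qed.

Lemma derives_yields s t w : derive s t -> yields setT t w -> yields setT s w.
Proof.
move=> st; elim: st w => {s t} [s t [p [q [A [rhs [AG -> ->]]]]]||] w; last by eauto.
  case/yields_catP=> w1 [w' [-> Hp /yields_catP [w2 [w3 [-> Hrhs Hq]]]]].
  by apply: yields_cat Hp _; apply: YieldsNonterminal AG Hrhs Hq; rewrite inE.
by [].
Qed.

(** Later siblings are searched first, then the subtree, then its root, so the chosen [A] has no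
    other [A] below it. For [s] equal to [A] alone, the derivation found is a [pump]. *)
Lemma yields_last A S s w : yields S s w ->
  yields (S :\ A) s w \/
  exists u v rhs w1, [/\ w = u ++ w1 ++ v, (A, rhs) \in productions G,
    yields (S :\ A) rhs w1 & derive s (word u ++ inl A :: word v)].
Proof.
elim=> {s w} [|a s w _ [IH|IH]|B rhs s w1 w2 BS BG H1 IH1 H2 IH2].
- by left; constructor.
- by left; constructor.
- case: IH => u [v [rhs [w1 [-> AG H D]]]]; right.
  exists (a :: u), v, rhs, w1; split=> //.
  exact: (derives_cat (rt_refl _ _ [:: inr a]) D).
- have D : derive [:: inl B] (word w1).
    exact: rt_trans (derives_prod BG) (yields_derives H1).
  case: IH2 => [{}H2|]; last first.
    case=> u [v [rhs' [w [-> AG H D']]]]; right.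
    exists (w1 ++ u), v, rhs', w; split=> //; first by rewrite -!catA.
    rewrite map_cat -catA; exact: (derives_cat D D').
  case: IH1 => [{}H1|]; last first.
    case=> u [v [rhs' [w [-> AG H D']]]]; right.
    exists u, (v ++ w2), rhs', w; split=> //; first by rewrite -!catA.
    have := derives_cat (rt_trans _ _ _ _ _ (derives_prod BG) D') (yields_derives H2).
    by rewrite -catA map_cat.
  case: (eqVneq B A) => [BA|BA].
    subst B; right; exists [::], w2, rhs, w1; split=> //=.
    exact: (derives_cat (rt_refl _ _ [:: inl A]) (yields_derives H2)).
  by left; apply: YieldsNonterminal BG H1 H2; rewrite !inE BA.
Qed.

(** * Pumping and commutation *)

Definition pump A u v := derive [:: inl A] (word u ++ inl A :: word v).

Lemma pump_cat A u v u' v' : pump A u v -> pump A u' v' -> pump A (u ++ u') (v' ++ v).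
Proof.
move=> H H'; apply: rt_trans H _.
by have := derives_context (word u) (word v) H'; rewrite /= !map_cat -!catA.
Qed.

Lemma pump_prouhetl A u v u' v' j : pump A u v -> pump A u' v' ->
  exists z, pump A (prouhet j u u') z.
Proof.
move=> H H'; suff [//] : (exists z, pump A (prouhet j u u') z) /\
    exists z, pump A (prouhet j u' u) z.
elim: j => [|j [[z IH] [z' IH']]] /=; first by split; [exists v | exists v'].
by split; [exists (z' ++ z) | exists (z ++ z')]; apply: pump_cat.
Qed.

Lemma pump_prouhetr A u v u' v' j : pump A u v -> pump A u' v' ->
  exists z, pump A z (prouhet j v v').
Proof.
move=> H H'; suff [//] : (exists z, pump A z (prouhet j v v')) /\
    exists z, pump A z (prouhet j v' v).
elim: j => [|j [[z IH] [z' IH']]] /=; first by split; [exists u | exists u'].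
by split; [exists (z' ++ z) | exists (z ++ z')]; apply: pump_cat.
Qed.

Definition reachable s := exists p q, derive [:: inl (start G)] (word p ++ s ++ word q).
Definition productive A := exists w, derive [:: inl A] (word w).

Lemma reachable_derives s t : reachable s -> derive s t -> reachable t.
Proof.
move=> [p [q H]] st; exists p, q; exact: rt_trans H (derives_context _ _ st).
Qed.

Lemma reachable_factor u v s : reachable (word u ++ s ++ word v) -> reachable s.
Proof.
by move=> [p [q H]]; exists (p ++ u), (v ++ q); rewrite !map_cat -!catA in H *.
Qed.

Lemma uniform_bound (I : finType) (P : I -> nat -> Prop) :
  (forall i m n, m <= n -> P i m -> P i n) -> (forall i, exists n, P i n) ->
  exists n, forall i, P i n.
Proof.
move=> mono H; suff [n Hn] : exists n, forall i, i \in enum I -> P i n.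
  by exists n => i; apply: Hn; rewrite mem_enum.
elim: (enum I) => [|i s [n IH]]; first by exists 0.
have [m Hm] := H i; exists (maxn m n) => j; rewrite inE => /orP [/eqP ->|/IH].
  by apply: mono Hm; rewrite leq_maxl.
by apply: mono; rewrite leq_maxr.
Qed.

Section FewBlocks.

Variable k : nat.
Hypothesis avoid : forall p q x y,
  cfg_language G (p ++ prouhet k x y ++ q) -> x ++ y = y ++ x.

(** Nested pumps produce P_k on either chosen side of [A]; reachability and productivity complete
    this to a word of the language. *)
Lemma pump_commute A u v u' v' : reachable [:: inl A] -> productive A ->
  pump A u v -> pump A u' v' -> u ++ u' = u' ++ u /\ v ++ v' = v' ++ v.
Proof.
move=> [p [q Dp]] [w Dw] H H'; split.
  have [z Hz] := pump_prouhetl k H H'; apply: (@avoid p (w ++ z ++ q)).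
  apply: rt_trans Dp _; rewrite !map_cat.
  apply: derives_cat; first exact: rt_refl.
  rewrite !catA; apply: derives_cat; last exact: rt_refl.
  apply: rt_trans Hz _; rewrite -catA -cat1s.
  by apply: derives_context.
have [z Hz] := pump_prouhetr k H H'; apply: (@avoid (p ++ z ++ w) q).
apply: rt_trans Dp _; rewrite !map_cat -!catA.
apply: derives_cat; first exact: rt_refl.
rewrite !catA; apply: derives_cat; last exact: rt_refl.
apply: rt_trans Hz _; rewrite -catA -cat1s.
by apply: derives_context.
Qed.

Lemma commuting_root (x0 : T) (P : seq T -> Prop) :
  (forall u u', P u -> P u' -> u ++ u' = u' ++ u) ->
  exists r, 0 < size r /\ forall u, P u -> u ++ r = r ++ u.
Proof.
move=> comm; case: (classic (exists r, P r /\ 0 < size r)) => [[r [Pr r0]]|none].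
  by exists r; split=> // u Pu; apply: comm.
(* Here only the empty word can satisfy [P], so any nonempty word serves as [r]. *)
exists [:: x0]; split=> // -[|a u] // Pu.
by case: none; exists (a :: u).
Qed.

(** Commuting with [r] gives a word the period [size r]; thus [C] bounds the periods of all words
    pumped at [A]. *)
Definition period_bound A C := reachable [:: inl A] -> productive A ->
  exists r r', [/\ 0 < size r <= C, 0 < size r' <= C &
    forall u v, pump A u v -> u ++ r = r ++ u /\ v ++ r' = r' ++ v].

Lemma period_bound_exists (x0 : T) : exists C, forall A, period_bound A C.
Proof.
apply: uniform_bound => [A m n mn H rA pA|A].
  have [r [r' [/andP [r0 rm] /andP [r'0 r'm] H']]] := H rA pA.
  by exists r, r'; split=> //; rewrite ?r0 ?r'0 (leq_trans _ mn).
case: (classic (reachable [:: inl A] /\ productive A)) => [[rA pA]|n]; last first.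
  by exists 0 => rA pA; case: n.
have [|r [r0 Hr]] := @commuting_root x0 (fun u => exists v, pump A u v).
  by move=> u u' [v H] [v' H']; case: (pump_commute rA pA H H').
have [|r' [r'0 Hr']] := @commuting_root x0 (fun v => exists u, pump A u v).
  by move=> v v' [u H] [u' H']; case: (pump_commute rA pA H H').
exists (maxn (size r) (size r')) => _ _; exists r, r'.
rewrite r0 r'0 leq_maxl leq_maxr; split=> // u v H.
by split; [apply: Hr; exists v | apply: Hr'; exists u].
Qed.

Definition max_rhs := \max_(pr <- productions G) size pr.2.

(* Four blocks for the two pumped words around the last occurrence of a
   nonterminal, which is then expanded without using it again. *)
Fixpoint block_bound n := if n is n'.+1 then 4 + max_rhs * block_bound n' else 1.

Lemma block_bound_gt0 n : 0 < block_bound n.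
Proof. by case: n. Qed.

(** The two pumped words are factors of a word with long blocks and commute with short words, hence
    have at most two blocks each. *)
Lemma blocks_pumped C S A w : period_bound A C -> reachable [:: inl A] ->
  yields S [:: inl A] w -> long_blocks C w ->
  exists rhs w', [/\ blocks w <= 4 + blocks w', long_blocks C w',
    reachable rhs, size rhs <= max_rhs & yields (S :\ A) rhs w'].
Proof.
move=> HC rA H long.
have pA : productive A by exists w; apply: yields_derives H.
have [r [r' [r_le r'_le Hrr']]] := HC rA pA.
case: (yields_last A H) => [H'|[u [v [rhs [w' [E AG Hrhs Huv]]]]]].
  by inversion H' as [| |? ? ? ? ? AS]; subst; rewrite !inE eqxx in AS.
have [ur vr'] := Hrr' _ _ Huv; exists rhs, w'.
rewrite E in long *; have long' := long_blocks_catr long; split=> //.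
- have u2 := long_blocks_commute (long_blocks_catl long) r_le ur.
  have v2 := long_blocks_commute (long_blocks_catr long') r'_le vr'.
  rewrite (leq_trans (blocks_cat _ _)) // -[4]/(2 + 2) -addnA leq_add //.
  by rewrite (leq_trans (blocks_cat _ _)) // addnC leq_add.
- exact: long_blocks_catl long'.
- exact: reachable_derives rA (derives_prod AG).
- by rewrite /max_rhs (big_rem _ AG) leq_maxl.
Qed.

(** Outer induction on the size of [S], inner on [s]: a terminal adds at most one block, and a
    nonterminal is expanded by [blocks_pumped], which removes it from [S]. Reachability passes to
    each symbol by deriving the others to words. *)
Lemma yields_blocks C S s w : (forall A, period_bound A C) ->
  reachable s -> yields S s w -> long_blocks C w ->
  blocks w <= size s * block_bound #|S|.
Proof.
move=> HC; move En: #|S| => n.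
elim/ltn_ind: n => n IHn in S En s w *.
elim: s w => [|X s IHs] w rs H long;
  inversion H as [|a s' w' Hs|A rhs s' w1 w2 AS AG Hrhs Hs]; subst => //;
  rewrite [size _ * _]mulSn.
- have rs' : reachable s.
    by apply: (@reachable_factor [:: a] [::]); rewrite /= cats0.
  apply: leq_trans (blocks_cat [:: a] w') (leq_add (block_bound_gt0 _) _).
  exact: IHs _ rs' Hs (long_blocks_catr (u := [:: a]) long).
have HA : yields S [:: inl A] w1.
  by rewrite -(cats0 w1); apply: YieldsNonterminal AS AG Hrhs (YieldsNil _).
have rA : reachable [:: inl A].
  apply: (@reachable_factor [::] w2); apply: reachable_derives rs _.
  exact: (derives_cat (rt_refl _ _ [:: inl A]) (yields_derives Hs)).
have rs' : reachable s.
  apply: (@reachable_factor w1 [::]); rewrite cats0; apply: reachable_derives rs _.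
  exact: (derives_cat (yields_derives HA) (rt_refl _ _ s)).
have [rhs' [w' [le_w1 long' r_rhs' size_rhs' H']]] :=
  blocks_pumped (HC A) rA HA (long_blocks_catl long).
apply: leq_trans (blocks_cat w1 w2) (leq_add _ _); last first.
  exact: IHs _ rs' Hs (long_blocks_catr long).
have card_S : #|S| = #|S :\ A|.+1 by rewrite (cardsD1 A) AS.
rewrite card_S; apply: leq_trans le_w1 _; rewrite leq_add2l.
apply: leq_trans (IHn _ _ _ erefl _ _ r_rhs' H' long') (leq_mul size_rhs' (leqnn _)).
by rewrite card_S.
Qed.

End FewBlocks.
End Grammar.

(** * Spirals against the block bound *)

Lemma not_context_free (T : finType) (L : language T) (a b c : T) k :
  uniq [:: a; b; c] -> (forall C n, L (spiral C a b c n)) ->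
  (forall p q x y, L (p ++ prouhet k x y ++ q) -> x ++ y = y ++ x) ->
  ~ context_free L.
Proof.
move=> abc spiral_L avoid [G LG].
have avoidG p q x y : cfg_language G (p ++ prouhet k x y ++ q) -> x ++ y = y ++ x.
  by move/LG/avoid.
have [C HC] := period_bound_exists avoidG a.
(* Both [C] and [n] depend on the grammar only; the spiral chosen afterwards has at least [n.+1]
   blocks. *)
pose n := block_bound G #|[set: nonterminal G]|.
have /LG D := spiral_L C n.+1.
have start_reachable : reachable [:: inl (start G)].
  by exists [::], [::]; apply: rt_refl.
have := yields_blocks HC start_reachable (derives_yields D (yields_word _ _))
  (long_blocks_spiral C a b c n.+1).
by rewrite mul1n => /(leq_trans (blocks_spiral C n.+1 abc)); rewrite ltnn.
Qed.

Theorem theorem17 (d : Order.disp_t) (Sigma : finOrderType d) (k : nat)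
    (card_Sigma : 3 <= #|Sigma|) (k_ge2 : 2 <= k) :
  ~ context_free (@LL d Sigma k) /\ ~ context_free (@Sing Sigma k).
Proof.
have k0 : 0 < k by apply: leq_trans k_ge2.
have [a [b [c [_ [ab bc ca]]]]] := card_gt2P card_Sigma.
have abc : uniq [:: a; b; c] by rewrite /= !inE negb_or ab bc eq_sym ca.
(* Index [k.+1] is used because its two halves are the k-equivalent words to be exchanged. *)
split; apply: (not_context_free (k := k.+1) abc).
- move=> C n u /(spiral_singleton abc k_ge2) ->.
  exact: Order.POrderTheory.lexx.
- by move=> p q x y; apply: LL_prouhet.
- move=> C n; exists (spiral C a b c n); split=> // u.
  by move/(spiral_singleton abc k_ge2).
- by move=> p q x y; apply: Sing_prouhet.
Qed.
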